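(* Let $k$ and $t$ be positive integers. Then $T_{2k+1}(K_t)$ and $T_{2k}(K_{t,t})$ are layered. Moreover, with $k,t$ fixed and $n\to\infty$, $$\mathrm{ex}(Q_n, T_{2k+1}(K_t)) = O(n^b 2^n) = o(\|Q_n\|), \quad\text{where } b = 1-(k+1)^{-1}t^{-k}.$$ If, in addition, $k\ge 4$ is even, then $$\mathrm{ex}(Q_n, T_{2k}(K_{t,t})) = O(n^{b'}2^n) = o(\|Q_n\|), \quad\text{where } b' = 1-(2t^3+4t)^{-1}k^{-t^2}.$$
   Context: The hypercube $Q_n$ is the graph with vertex set $\{A : A\subseteq [n]\}$ and edge set all pairs $\{A,B\}$ with $A\subseteq B$ and $|A|=|B|-1$. $\|H\|$ denotes the number of edges of a graph $H$ (so $\|Q_n\|=n2^{n-1}$). The $k$th edge layer of $Q_n$ is the subgraph of $Q_n$ induced by $\binom{[n]}{k}\cup\binom{[n]}{k-1}$. A graph is layered if it is (isomorphic to) a subgraph of some edge layer of $Q_n$ for some $n$. For a graph $H$, $\mathrm{ex}(Q_n,H)$ is the largest number of edges in a subgraph $G$ of $Q_n$ such that no subgraph of $G$ is isomorphic to $H$. For a graph $G$ and a positive integer $k$, $T_k(G)$ is the $k$-subdivision of $G$: the graph obtained from $G$ by subdividing each edge with $k$ new vertices (each edge $xy$ is replaced by an $x,y$-path with $k$ new internal vertices, the new vertices being distinct for distinct edges). $K_t$ is the complete graph on $t$ vertices and $K_{t,t}$ the complete bipartite graph with parts of size $t$. *)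

(* Defs.v *)
From HB Require Import structures.
From mathcomp Require Import all_boot.
From mathcomp Require Import boolp.

Set Implicit Arguments.
Unset Strict Implicit.
Unset Printing Implicit Defensive.

Definition is_graph (T : finType) (p : {set T} * {set {set T}}) : bool :=
  [forall e in p.2, (e \subset p.1) && (#|e| == 2)].

(* A finite simple graph whose vertices are drawn from T: the vertex set may be
   a proper subset of T, so that a graph and its subgraphs share one type. *)
Record graph (T : finType) : Type :=
  Graph { gval :> {set T} * {set {set T}}; _ : is_graph gval }.

HB.instance Definition _ (T : finType) := [isSub for @gval T].
HB.instance Definition _ (T : finType) := [Finite of graph T by <:].

Definition vset (T : finType) (G : graph T) : {set T} := (gval G).1.
Definition eset (T : finType) (G : graph T) : {set {set T}} := (gval G).2.

Definition nedges (T : finType) (G : graph T) : nat := #|eset G|.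

Definition subgraph (T : finType) (F G : graph T) : bool :=
  (vset F \subset vset G) && (eset F \subset eset G).

Definition isomorphic (T U : finType) (G : graph T) (H : graph U) : Prop :=
  exists f : {x : T | x \in vset G} -> {y : U | y \in vset H},
    bijective f /\
    forall x y, ([set val x; val y] \in eset G) =
                ([set val (f x); val (f y)] \in eset H).

Definition is_free (T U : finType) (H : graph U) (G : graph T) : Prop :=
  ~ exists F : graph T, subgraph F G /\ isomorphic F H.

(* The maximum ranges over a set containing the edgeless graph without vertices,
   so it is attained, as soon as H has a vertex. *)
Definition extremal (T U : finType) (Q : graph T) (H : graph U) : nat :=
  \max_(G : graph T | subgraph G Q && `[< is_free H G >]) nedges G.

Lemma rel_graph_subproof (T : finType) (V : {set T}) (r : rel T) :
  is_graph (V, [set e : {set T} | [exists x in V, [exists y in V,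
                  [&& x != y, r x y & e == [set x; y]]]]]).
Proof.
apply/forall_inP => e; rewrite inE => /exists_inP[x xV /exists_inP[y yV]].
case/and3P=> xy _ /eqP->; rewrite cards2 xy andbT.
by apply/subsetP => z; rewrite !inE => /orP[]/eqP->.
Qed.

(* The graph on V joining distinct x and y as soon as r x y or r y x. *)
Definition rel_graph (T : finType) (V : {set T}) (r : rel T) : graph T :=
  Graph (rel_graph_subproof V r).

Lemma induced_subproof (T : finType) (G : graph T) (W : {set T}) :
  is_graph (vset G :&: W, [set e in eset G | e \subset W]).
Proof.
apply/forall_inP => e; rewrite inE => /andP[eG eW].
have /forall_inP/(_ e eG)/andP[eV ->] : is_graph G by case: (G).
by rewrite subsetI eV eW.
Qed.

Definition induced (T : finType) (G : graph T) (W : {set T}) : graph T :=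
  Graph (induced_subproof G W).

Definition hypercube (n : nat) : graph {set 'I_n} :=
  rel_graph [set: {set 'I_n}]
    (fun A B => (A \subset B) && (#|B| == #|A|.+1)).

Definition edge_layer (n k : nat) : graph {set 'I_n} :=
  induced (hypercube n) [set A : {set 'I_n} | (#|A| == k) || (#|A|.+1 == k)].

Definition layered (U : finType) (H : graph U) : Prop :=
  exists n k : nat, 0 < k <= n /\
    exists F : graph {set 'I_n}, subgraph F (edge_layer n k) /\ isomorphic F H.

Definition complete_graph (t : nat) : graph 'I_t :=
  rel_graph [set: 'I_t] (fun _ _ => true).

Definition complete_bipartite (s t : nat) : graph ('I_s + 'I_t)%type :=
  rel_graph [set: ('I_s + 'I_t)%type]
    (fun u v => match u, v with inl _, inr _ => true | _, _ => false end).

(* Each edge e must be traversed from one of its ends to the other; the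
   enumeration order of T fixes the direction.  Any other choice of directions
   gives an isomorphic subdivision. *)
Definition first_end (T : finType) (e : {set T}) (x : T) : bool :=
  (x \in e) && [forall y in e, enum_rank x <= enum_rank y].
Definition last_end (T : finType) (e : {set T}) (x : T) : bool :=
  (x \in e) && [forall y in e, enum_rank y <= enum_rank x].

(* inr (e, i) is the i-th new vertex on the edge e, counted from 0 at its first
   end.  The definition is meant for
   k > 0 (for k = 0 the edges of G would be lost). *)
Definition subdiv_vset (k : nat) (T : finType) (G : graph T) :
    {set (T + {set T} * 'I_k)%type} :=
  [set u | match u with
           | inl x => x \in vset G
           | inr (e, _) => e \in eset G
           end].

Definition subdiv_rel (k : nat) (T : finType) : rel (T + {set T} * 'I_k)%type :=
  fun u v =>
    match u, v with
    | inl x, inr (e, i) => (first_end e x && (i == 0 :> nat)) ||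
                           (last_end e x && (i.+1 == k))
    | inr (e, i), inr (e', j) => (e == e') && (i.+1 == j)
    | _, _ => false
    end.

Definition subdivision (k : nat) (T : finType) (G : graph T) :
    graph (T + {set T} * 'I_k)%type :=
  rel_graph (subdiv_vset k G) (@subdiv_rel k T).

(* Main.v *)
Require Import Defs.
From mathcomp Require Import all_boot all_order all_algebra.
From mathcomp Require Import all_classical all_reals all_analysis.
From mathcomp Require Import zify ring.
(* Names such as set0 and subsetP, which classical sets share, are those of
   finite sets. *)
From mathcomp Require Import fintype finset.
Import Order.TTheory GRing.Theory Num.Theory.
Import numFieldNormedType.Exports.

(** Encode the vertices of a graph H by distinct words of length r, the letter
    in position i being a number below s_i and at most one letter being erased,
    so that adjacent vertices receive a full word and the same word with one
    letter erased ([partite_rep]).  Given disjoint sets A_i of s_i coordinates,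
    and a set C of further coordinates, a word becomes the union of C and of
    the coordinates it names, and H is embedded into the cube; with C empty it
    lies in the r-th edge layer ([partite_rep_layered]).

    Such an encoding also bounds the extremal number ([extremal_bound]).  Let G
    be a subgraph of the cube.  For a set C, consider the r-tuples x of
    distinct coordinates outside C such that all r edges joining C + x to the
    sets C + x - x_i belong to G.  If this family of tuples contains a box
    A_1 * ... * A_r with |A_i| = s_i, then G contains H ([star_box_copy]).
    Otherwise Erdos's box theorem ([box_free_bound]) says that it has
    O(n^(r - 1/p)) members, where p is the product of all s_i but the last one.
    Summed over C, the sizes of these families give the sum over all sets B of
    the falling factorials d(B) (d(B) - 1) ... (d(B) - r + 1), where d(B) is the
    number of edges of G from B downwards ([sum_star_tuple]).  As G has
    sum d(B) edges, convexity ([sum_le_of_ffact]) yields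
    O(n^(1 - 1/(r p)) 2^n) edges.  The proof of the box theorem, by
    induction on r, is the same double counting and convexity argument.

    For the (2k+1)-subdivision of K_t, words have k letters below t followed by
    a letter naming an edge of K_t.  The branch vertex x is x...x with its last
    letter erased; the path of the edge e from x to y writes e at the end,
    changes the k letters x into y one after the other, each change being an
    erasure followed by a writing, and erases e.  Here r = k + 1 and p = t^k
    ([clique_rep]).

    For the 2k-subdivision of K_{t,t}, words have letters P_0, ..., P_(t-1)
    followed by z and Q.  The i-th left branch vertex has all P_j and Q equal
    to 0, and z = i.  Its path to the j-th right branch vertex increments P_j
    and Q alternately, k times in all, and then erases z.  Two consecutive
    changes of the same letter would go twice through the same word, which is
    why two letters have to alternate.  Here r = t + 2 and
    p = t (ceil(k/2) + 1)^t ([biclique_rep]), and r p is at most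
    (2 t^3 + 4 t) k^(t^2) as soon as k >= 3 ([biclique_exponent_le]). *)

Set Implicit Arguments.
Unset Strict Implicit.
Unset Printing Implicit Defensive.

(** * Boxes in families of sequences *)

(** The family E of words contains a product of sets with prescribed sizes s:
    [has_boxP] is the reading of this recursive definition.  The letters of a
    word are peeled off from the left, in the order needed by the induction of
    the box theorem. *)
Fixpoint has_box (X : finType) (s : seq nat) (E : seq X -> bool) : bool :=
  if s is m :: s' then
    [exists A : {set X}, (#|A| == m) &&
       has_box s' (fun y => [forall x in A, E (x :: y)])]
  else E [::].

Lemma has_boxP (X : finType) (s : seq nat) (E : seq X -> bool) :
  has_box s E -> exists2 A : seq {set X}, [seq #|a : {set X}| | a <- A] = s &
    forall y, all2 (fun x (a : {set X}) => x \in a) y A -> E y.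
Proof.
elim: s E => [|m s IHs] E /=; first by move=> En; exists [::] => // -[].
case/existsP => A /andP[/eqP Am /IHs[As <- EA]].
exists (A :: As) => [|[|x y]] //=; first by rewrite Am.
by case/andP=> xA /EA/forall_inP; apply.
Qed.

(** The power mean inequality, by induction from Chebyshev's sum inequality. *)
Lemma sum_pow_mean (T : finType) (x : T -> nat) (m : nat) :
  (\sum_y x y) ^ m.+1 <= #|T| ^ m * \sum_y x y ^ m.+1.
Proof.
have cheb a : (\sum_y x y) * (\sum_y x y ^ a) <= #|T| * \sum_y x y ^ a.+1.
  have D : (\sum_y x y) * (\sum_y x y ^ a) = \sum_y \sum_z x y * x z ^ a.
    by rewrite big_distrl; apply: eq_bigr => y _; rewrite big_distrr.
  have D' : #|T| * \sum_y x y ^ a.+1 = \sum_y \sum_(z : T) x y ^ a.+1.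
    rewrite big_distrr; apply: eq_bigr => y _.
    by rewrite sum_nat_const.
  rewrite -leq_double -!addnn {2}D {2}D' exchange_big [in X in _ <= _ + X]exchange_big.
  rewrite D D' -!big_split /=; apply: leq_sum => y _.
  rewrite -!big_split; apply: leq_sum => z _ /=; rewrite !expnS.
  have [yz|/ltnW zy] := leqP (x y) (x z).
    have : x y ^ a <= x z ^ a by case: (a) => // b; rewrite leq_exp2r.
    nia.
  have : x z ^ a <= x y ^ a by case: (a) => // b; rewrite leq_exp2r.
  nia.
elim: m => [|m IHm]; first by rewrite mul1n.
rewrite expnS (leq_trans (leq_mul (leqnn _) IHm)) // mulnCA expnSr -mulnA.
by rewrite leq_mul2l cheb orbT.
Qed.

Lemma subn_expn_ffact (d m : nat) : (d - m) ^ m <= d ^_ m.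
Proof.
elim: m d => [|m IHm] d //; case: d => [|d]; first by rewrite sub0n exp0n.
rewrite subSS expnS ffactSS leq_mul // ?(leq_trans (leq_subr _ _)) //.
Qed.

Lemma sum_nat_of_bool (T : finType) (P Q : pred T) :
  \sum_(x | P x) (Q x : nat) = #|[set x | P x && Q x]|.
Proof. by rewrite -sum1dep_card big_mkcondr. Qed.

Lemma sum_card_slice (S T : finType) (P : S -> T -> bool) :
  \sum_x #|[set y | P x y]| = #|[set p : S * T | P p.1 p.2]|.
Proof.
rewrite -sum1dep_card -(pair_big_dep xpredT P (fun _ _ => 1)).
by apply: eq_bigr => x _; rewrite sum1dep_card.
Qed.

(** Both sides count the pairs of a word y and an m-tuple of distinct letters,
    each of which may be put in front of y. *)
Lemma sum_ffact_slice (X : finType) (r m : nat) (E : seq X -> bool) :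
  \sum_(y : r.-tuple X) #|[set x | E (x :: y)]| ^_ m =
  \sum_(a : m.-tuple X | uniq a)
     #|[set y : r.-tuple X | [forall x in [set x in a], E (x :: y)]]|.
Proof.
transitivity (\sum_(y : r.-tuple X) \sum_(a : m.-tuple X | uniq a)
    (all (fun x => E (x :: y)) a : nat)).
  apply: eq_bigr => y _; rewrite -card_uniq_tuples sum_nat_of_bool.
  apply: eq_card => a; rewrite !inE andbC; congr (_ && _).
  by apply: eq_all => x; exact: (in_set (fun x => E (x :: y)) x).
rewrite exchange_big; apply: eq_bigr => a _; rewrite sum_nat_of_bool.
apply: eq_card => y; rewrite !inE /=; apply/allP/forall_inP => H x; rewrite ?inE.
  exact: H.
by move=> xa; apply: H; rewrite inE.
Qed.

Lemma card_set_cons (X : finType) (r : nat) (E : seq X -> bool) :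
  #|[set y : r.+1.-tuple X | E y]| =
  \sum_(y : r.-tuple X) #|[set x | E (x :: y)]|.
Proof.
rewrite sum_card_slice.
pose h (y : r.+1.-tuple X) := ([tuple of behead y], thead y).
have hK : cancel h (fun p => [tuple of p.2 :: p.1]).
  by move=> y; rewrite [RHS]tuple_eta; apply: val_inj.
rewrite -(card_imset _ (can_inj hK)); apply: eq_card => -[y x]; rewrite !inE /=.
apply/imsetP/idP => [[z] | Exy]; last first.
  by exists [tuple of x :: y]; rewrite ?inE //; congr pair; apply: val_inj.
by rewrite inE => Ez [-> ->]; move: Ez; rewrite {1}(tuple_eta z).
Qed.

Lemma box_free_slice (X : finType) (m : nat) (s : seq nat) (E : seq X -> bool)
    (a : m.-tuple X) : ~~ has_box (m :: s) E -> uniq a ->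
  ~~ has_box s (fun y => [forall x in [set x in a], E (x :: y)]).
Proof.
move=> /= nE ua; apply: contra nE => Ea; apply/existsP; exists [set x in a].
by rewrite Ea cardsE (card_uniqP ua) size_tuple eqxx.
Qed.

(** * Edges of the hypercube *)

(** The coordinates whose removal from B is an edge of G; their number is the
    degree of B towards the level below it. *)
Definition down_nbr (n : nat) (G : graph {set 'I_n}) (B : {set 'I_n}) :
  {set 'I_n} := [set x in B | [set B :\ x; B] \in eset G].

(** Every edge of the cube removes one coordinate from its upper end. *)
Lemma hypercubeP (n : nat) (e : {set {set 'I_n}}) :
  reflect (exists (B : {set 'I_n}) (x : 'I_n), x \in B /\ e = [set B :\ x; B])
          (e \in eset (hypercube n)).
Proof.
rewrite inE; apply: (iffP idP) => [/exists_inP[A _ /exists_inP[B _]]|].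
  case/and3P=> AB /andP[sAB /eqP cB] /eqP ->.
  have /cards1P[x Dx] : #|B :\: A| == 1 by rewrite cardsD (setIidPr sAB) cB; lia.
  have xB : x \in B by have := set11 x; rewrite -Dx inE => /andP[].
  by exists B, x; split => //; rewrite -Dx setDDr setDv set0U (setIidPr sAB).
case=> B [x [xB ->]]; apply/exists_inP; exists (B :\ x) => //.
apply/exists_inP; exists B => //; rewrite eqxx subD1set (cardsD1 x B) xB add1n.
by rewrite eqxx !andbT; apply/eqP => DB; have := xB; rewrite -DB !inE eqxx.
Qed.

Lemma nedges_down (n : nat) (G : graph {set 'I_n}) : subgraph G (hypercube n) ->
  nedges G = \sum_B #|down_nbr G B|.
Proof.
case/andP=> _ /subsetP sG.
pose h (p : {set 'I_n} * 'I_n) := [set p.1 :\ p.2; p.1].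
pose P := [set p : {set 'I_n} * 'I_n | p.2 \in down_nbr G p.1].
have -> : \sum_B #|down_nbr G B| = #|P|.
  rewrite -(sum_card_slice (fun B x => x \in down_nbr G B)).
  apply: eq_bigr => B _.
  by apply: eq_card => x; rewrite [RHS]in_set.
have hinj : {in P &, injective h}.
  move=> [B x] [B' x']; rewrite !inE /= => /andP[xB _] /andP[x'B' _] Dh.
  have cB : #|B| = #|B :\ x|.+1 by rewrite (cardsD1 x B) xB.
  have cB' : #|B'| = #|B' :\ x'|.+1 by rewrite (cardsD1 x' B') x'B'.
  have E2 : B :\ x \in h (B', x') by rewrite -Dh set21.
  have E3 : B \in h (B', x') by rewrite -Dh set22.
  have DB : B = B'.
    have E1 : B' \in h (B, x) by rewrite Dh set22.
    move: E1 E3; rewrite !inE /= => /orP[] /eqP E1 // /orP[] /eqP E3 //.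
    by move: cB cB'; rewrite -E1 -E3; lia.
  rewrite -DB in E2 *; congr pair; move: E2; rewrite !inE /= => /orP[] /eqP E2.
    have : x \notin B :\ x by rewrite !inE eqxx.
    by rewrite E2 !inE xB andbT negbK => /eqP.
  by move: cB; rewrite E2; lia.
rewrite -(card_in_imset hinj) /nedges; apply: eq_card => e.
apply/idP/imsetP => [eG | [[B x]]].
  have /hypercubeP[B [x [xB De]]] := sG e eG.
  by exists (B, x) => //; rewrite !inE /= xB -De.
by rewrite !inE /= => /andP[_ eG] ->.
Qed.

Lemma nedges_hypercube (n : nat) : (nedges (hypercube n)).*2 = n * 2 ^ n.
Proof.
rewrite nedges_down; last by rewrite /subgraph !subxx.
have -> : \sum_B #|down_nbr (hypercube n) B| = \sum_(B : {set 'I_n}) #|B|.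
  apply: eq_bigr => B _; apply: eq_card => x; rewrite inE; case xB: (x \in B) => //=.
  by apply/hypercubeP; exists B, x.
rewrite -addnn {1}(reindex_inj (@setC_inj _)) -big_split /=.
under eq_bigr do rewrite addnC cardsC.
by rewrite sum_nat_const card_ord mulnC -cardsT -powersetT card_powerset cardsT card_ord.
Qed.

(** * Partite representations and copies of a graph in a cube *)

Lemma isomorphic_sym (T U : finType) (G : graph T) (H : graph U) :
  isomorphic G H -> isomorphic H G.
Proof.
case=> f [[g fK gK] Ef]; exists g; split; first by exists f.
by move=> x y; rewrite Ef !gK.
Qed.

Lemma copy_of_injection (T U : finType) (G : graph T) (H : graph U)
    (f : U -> T) :
  {in vset H &, injective f} -> {in vset H, forall u, f u \in vset G} ->
  {in vset H &, forall u v, [set u; v] \in eset H ->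
     [set f u; f v] \in eset G} ->
  exists F : graph T, subgraph F G /\ isomorphic F H.
Proof.
move=> finj fV fE.
have Hg e : e \in eset H -> e \subset vset H /\ #|e| == 2.
  have /forall_inP/(_ e) : is_graph H by case: (H).
  by move=> He /He /andP[].
have Fg : is_graph (f @: vset H, (fun e : {set U} => f @: e) @: eset H).
  apply/forall_inP => _ /imsetP[e eH ->] /=; have [eV e2] := Hg e eH.
  rewrite imsetS //= card_in_imset // => u v ue ve.
  by apply: finj; apply: (subsetP eV).
exists (Graph Fg); split.
  apply/andP; split; first by apply/subsetP => _ /imsetP[u uH ->]; apply: fV.
  apply/subsetP => _ /imsetP[e eH ->]; have [/subsetP eV e2] := Hg e eH.
  case/cards2P: e2 => u [v [_ De]]; rewrite De imsetU !imset_set1.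
  by apply: fE; rewrite ?eV -?De // De !inE eqxx ?orbT.
apply: isomorphic_sym.
pose h (y : {y : U | y \in vset H}) : {x : T | x \in vset (Graph Fg)} :=
  Sub (f (val y)) (imset_f f (valP y)).
have hinj : injective h.
  move=> y z /(congr1 val) /= /finj Dyz; apply: val_inj.
  by apply: Dyz; apply: valP.
exists h; split.
  by apply: (inj_card_bij hinj); rewrite !card_sig (card_in_imset finj).
move=> x y /=; apply/idP/imsetP => [xy|[e eH]].
  by exists [set val x; val y]; rewrite // imsetU !imset_set1.
have [/subsetP eV _] := Hg e eH.
move=> De; suff -> : [set val x; val y] = e by [].
have xyV : {subset [set val x; val y] <= vset H}.
  by move=> z; rewrite !inE => /orP[]/eqP->; apply: valP.
apply/setP => z; apply/idP/idP => zin.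
  have : f z \in f @: e by rewrite -De; move: zin => /set2P[] ->; rewrite ?set21 ?set22.
  by case/imsetP => z' z'e Dz; rewrite (finj z z' (xyV _ zin) (eV _ z'e) Dz).
have : f z \in f @: [set val x; val y].
  by rewrite imsetU !imset_set1 De imset_f.
by case/imsetP => z' z'e Dz; rewrite (finj z z' (eV _ zin) (xyV _ z'e) Dz).
Qed.

(** Words of length r are functions on nat, of which only the values at
    positions below r matter; None stands for an erased letter.  The word w' is
    obtained from the full word w by erasing one letter. *)
Definition erases (r : nat) (w w' : nat -> option nat) : Prop :=
  exists i, [/\ i < r, forall j, j < r -> w j != None, w' i = None &
    forall j, j < r -> j != i -> w' j = w j].

(** The word has positive length and at most one erased letter. *)
Definition near_full (r : nat) (w : nat -> option nat) : Prop :=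
  exists2 i, i < r & forall j, j < r -> j != i -> w j != None.

(** An encoding of the vertices of H by words with letters bounded by s, as
    described at the top of the file.  The condition [rep_near_full] only
    matters for isolated vertices, whose images must be vertices of the host. *)
Record partite_rep (U : finType) (H : graph U) (s : seq nat)
    (w : U -> nat -> option nat) : Prop := PartiteRep {
  rep_bound : {in vset H, forall u i a, i < size s -> w u i = Some a ->
    a < nth 0 s i};
  rep_near_full : {in vset H, forall u, near_full (size s) (w u)};
  rep_inj : {in vset H &, forall u v,
    (forall i, i < size s -> w u i = w v i) -> u = v};
  rep_edge : {in vset H &, forall u v, [set u; v] \in eset H ->
    erases (size s) (w u) (w v) \/ erases (size s) (w v) (w u)}
}.

(** The coordinate g i a represents the letter a at position i. *)
Section Placement.

Variables (n : nat) (C : {set 'I_n}) (g : nat -> nat -> 'I_n) (r : nat).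

(** The set of coordinates represented by a word, placed above C. *)
Definition place (w : nat -> option nat) : {set 'I_n} :=
  C :|: [set y in pmap (fun i => omap (g i) (w i)) (iota 0 r)].

Lemma placeP (w : nat -> option nat) (y : 'I_n) :
  reflect (y \in C \/ exists i a, [/\ i < r, w i = Some a & y = g i a])
    (y \in place w).
Proof.
rewrite !inE; apply: (iffP orP) => -[yC|yw]; [by left | right | by left | right].
  move: yw; rewrite mem_pmap => /mapP[i]; rewrite mem_iota /= => ir.
  by case wi: (w i) => [a|] //= [->]; exists i, a.
case: yw => i [a [ir wi ->]]; rewrite mem_pmap; apply/mapP; exists i.
  by rewrite mem_iota.
by rewrite wi.
Qed.

Lemma eq_place (w w' : nat -> option nat) :
  (forall i, i < r -> w i = w' i) -> place w = place w'.
Proof.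
move=> D; congr (C :|: _); apply/setP => y; rewrite !inE.
congr (y \in _); apply: eq_in_pmap => i; rewrite mem_iota => /D.
by move->.
Qed.

Variable m : nat -> nat.
Hypothesis g_inj : forall i j a b, i < r -> j < r -> a < m i -> b < m j ->
  g i a = g j b -> i = j /\ a = b.
Hypothesis g_notin : forall i a, i < r -> a < m i -> g i a \notin C.

Lemma place_inj (w w' : nat -> option nat) :
  (forall i a, i < r -> w i = Some a -> a < m i) ->
  (forall i a, i < r -> w' i = Some a -> a < m i) ->
  place w = place w' -> forall i, i < r -> w i = w' i.
Proof.
have sub (v v' : nat -> option nat) i a :
    (forall i a, i < r -> v i = Some a -> a < m i) ->
    (forall i a, i < r -> v' i = Some a -> a < m i) ->
    place v = place v' -> i < r -> v i = Some a -> v' i = Some a.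
  move=> bv bv' D ir via.
  have : g i a \in place v by apply/placeP; right; exists i, a.
  rewrite D => /placeP[]; first by rewrite (negPf (g_notin ir (bv _ _ ir via))).
  case=> j [b [jr v'j /g_inj]]; case; rewrite // ?(bv _ _ ir via) ?bv' //.
  by move=> -> ->.
move=> bw bw' D i ir; case wi: (w i) => [a|].
  by rewrite (sub _ _ _ _ bw bw' D ir wi).
by case w'i: (w' i) => [a|] //; rewrite -wi (sub _ _ _ _ bw' bw (esym D) ir w'i).
Qed.

Lemma place_erase (w w' : nat -> option nat) (i a : nat) :
  (forall j b, j < r -> w j = Some b -> b < m j) ->
  i < r -> w i = Some a -> w' i = None ->
  (forall j, j < r -> j != i -> w' j = w j) ->
  place w' = place w :\ g i a.
Proof.
move=> bw ir wi w'i Dw'; apply/setP => y; rewrite in_setD1.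
apply/placeP/andP => [[yC|[j [b [jr w'j ->]]]] | [ya /placeP[yC|[j [b [jr wj Dy]]]]]].
- split; last by apply/placeP; left.
  by apply: contraTneq yC => ->; apply: g_notin (bw _ _ ir wi).
- have ji : j != i by apply: contra_eqN w'j => /eqP->; rewrite w'i.
  move: w'j; rewrite Dw' // => wj; split; last by apply/placeP; right; exists j, b.
  by apply: contraNneq ji => /g_inj[]; rewrite ?(bw _ _ _ wj) ?(bw _ _ _ wi) // => ->.
- by left.
right; exists j, b; split; rewrite // Dw' //.
apply: contraNneq ya => Dj; move: wj Dy; rewrite Dj wi => -[->] ->; exact: eqxx.
Qed.

End Placement.

(** A graph G on the vertices of the cube contains H as soon as it contains all
    edges that remove one letter from the placement of a full word. *)
Lemma partite_rep_copy (U : finType) (H : graph U) (s : seq nat)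
    (w : U -> nat -> option nat) (n : nat) (G : graph {set 'I_n})
    (C : {set 'I_n}) (g : nat -> nat -> 'I_n) :
  partite_rep H s w -> all (leq 1) s ->
  (forall i j a b, i < size s -> j < size s -> a < nth 0 s i -> b < nth 0 s j ->
     g i a = g j b -> i = j /\ a = b) ->
  (forall i a, i < size s -> a < nth 0 s i -> g i a \notin C) ->
  (forall f : nat -> nat, (forall i, i < size s -> f i < nth 0 s i) ->
     forall i, i < size s ->
     let B := place C g (size s) (Some \o f) in
     [set B :\ g i (f i); B] \in eset G) ->
  exists F : graph {set 'I_n}, subgraph F G /\ isomorphic F H.
Proof.
move=> [wb wf wi we] s_gt0 ginj gC gE.
have edge u v : u \in vset H ->
    (forall i a, i < size s -> v i = Some a -> a < nth 0 s i) ->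
    erases (size s) v (w u) ->
    [set place C g (size s) (w u); place C g (size s) v] \in eset G.
  move=> uH bv [i [ir vf wui Dw]].
  pose f j := odflt 0 (v j).
  have Dv j : j < size s -> v j = Some (f j).
    by move=> /vf; rewrite /f; case: (v j).
  have -> : place C g (size s) v = place C g (size s) (Some \o f).
    exact: eq_place.
  rewrite (@place_erase _ _ _ _ _ ginj gC (Some \o f) (w u) i (f i)) //.
  - by apply: gE => // j jr; apply: bv (Dv _ _).
  - by move=> j b jr [<-]; apply: bv (Dv _ _).
  - by move=> j jr ji; rewrite Dw // Dv.
have gV e x : e \in eset G -> x \in e -> x \in vset G.
  have /forall_inP/(_ e) : is_graph G by case: (G).
  by move=> He /He /andP[/subsetP eV _]; apply: eV.
apply: (@copy_of_injection _ _ _ _ (fun u => place C g (size s) (w u))).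
- move=> u v uH vH D; apply: wi => //.
  by apply: (@place_inj _ _ _ _ _ ginj gC) => // i a; apply: wb.
- move=> u uH; have [i ir wui] := wf u uH.
  pose f j := odflt 0 (w u j).
  have fb j : j < size s -> f j < nth 0 s j.
    move=> jr; rewrite /f; case wj: (w u j) => [a|]; first exact: wb wj.
    by apply: (allP s_gt0); apply: mem_nth.
  have fE := gE f fb i ir; case wi0: (w u i) => [a|].
    suff -> : place C g (size s) (w u) = place C g (size s) (Some \o f).
      by apply: gV fE _; rewrite set22.
    apply: eq_place => j jr; rewrite /= /f.
    have [->|/(wui j jr)] := eqVneq j i; first by rewrite wi0.
    by case: (w u j).
  (* The erased letter of w u is the only one for which f takes its default
     value 0, so that w u arises from f by erasing position i. *)
  apply: gV fE _; rewrite -(@place_erase _ _ _ _ _ ginj gC _ (w u)) ?set21 //.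
    by move=> j b jr [<-]; apply: fb.
  by move=> j jr /(wui j jr); rewrite /= /f; case: (w u j).
move=> u v uH vH /(we u v uH vH)[] E; last by apply: edge => // i a; apply: wb.
by rewrite setUC; apply: edge => // i a; apply: wb.
Qed.

Lemma placeE n (C : {set 'I_n}) (g : nat -> nat -> 'I_n) r (f : nat -> nat) :
  place C g r (Some \o f) = C :|: [set y in mkseq (fun i => g i (f i)) r].
Proof.
apply/setP => y; rewrite [RHS]in_setU [X in _ || X]in_set.
apply/placeP/orP => -[yC|yw]; try by left.
  case: yw => i [a [ir [<-] ->]]; right.
  by apply/mapP; exists i; rewrite ?mem_iota.
right; case/mapP: yw => i; rewrite mem_iota => /andP[_ ir] ->.
by exists i, (f i).
Qed.

Lemma card_place_full n (g : nat -> nat -> 'I_n) r (f m : nat -> nat) :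
  (forall i j a b, i < r -> j < r -> a < m i -> b < m j ->
     g i a = g j b -> i = j /\ a = b) ->
  (forall i, i < r -> f i < m i) ->
  #|place set0 g r (Some \o f)| = r.
Proof.
move=> ginj fm; rewrite placeE set0U cardsE.
have /card_uniqP -> : uniq (mkseq (fun i => g i (f i)) r).
  rewrite /mkseq map_inj_in_uniq ?iota_uniq // => i j.
  by rewrite !mem_iota => ir jr /ginj[]; rewrite ?fm.
by rewrite size_mkseq.
Qed.

(** Placing the words above the empty set puts full words at level r and the
    other ones at level r - 1, where r is the length of the words. *)
Lemma partite_rep_layered (U : finType) (H : graph U) (s : seq nat)
    (w : U -> nat -> option nat) :
  partite_rep H s w -> 0 < size s -> all (leq 1) s -> layered H.
Proof.
move=> wP s_gt0 s1; set r := size s in s_gt0.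
pose M := \max_(m <- s) m.
have ltM i : i < r -> nth 0 s i <= M.
  by move=> ir; rewrite /M (big_nth 0) big_mkord (leq_bigmax (Ordinal ir)).
have M_gt0 : 0 < M.
  by apply: leq_trans (ltM _ s_gt0); apply: (allP s1); apply: mem_nth.
pose N := r * M.
have N_gt0 : 0 < N by rewrite muln_gt0 s_gt0.
have leN : r <= N by rewrite leq_pmulr.
pose g i a : 'I_N := insubd (Ordinal N_gt0) (i * M + a).
have ginj i j a b : i < r -> j < r -> a < nth 0 s i -> b < nth 0 s j ->
    g i a = g j b -> i = j /\ a = b.
  move=> ir jr /leq_trans/(_ (ltM _ ir)) aM /leq_trans/(_ (ltM _ jr)) bM.
  move/(congr1 val); rewrite !val_insubd.
  have -> : i * M + a < N by rewrite /N; nia.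
  have -> : j * M + b < N by rewrite /N; nia.
  move=> D; have := congr1 (divn^~ M) D; have := congr1 (modn^~ M) D.
  by rewrite /= !modnMDl !divnMDl // !modn_small // !divn_small // !addn0.
exists N, r; split; first by rewrite s_gt0.
apply: (partite_rep_copy wP s1 (C := set0) ginj) => [i a _ _|f fs i ir].
  by rewrite inE.
cbv zeta; set B := place _ _ _ _.
have cB : #|B| = r by apply: card_place_full ginj fs.
have gB : g i (f i) \in B by apply/placeP; right; exists i, (f i).
have := cardsD1 (g i (f i)) B; rewrite cB gB => cB'.
rewrite inE; apply/andP; split.
  by apply/hypercubeP; exists B, (g i (f i)).
by apply/subsetP => A /set2P[] ->; rewrite inE ?cB ?eqxx // cB' add1n eqxx orbT.
Qed.

(** * From boxes to copies *)

(** The tuple x consists of distinct coordinates outside C, and G contains all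
    edges from C + x to the sets C + x - y, for y in x. *)
Definition star_tuple (n : nat) (G : graph {set 'I_n}) (C : {set 'I_n})
    (x : seq 'I_n) : bool :=
  let B := C :|: [set y in x] in
  [&& uniq x, all (fun y => y \notin C) x &
    all (fun y => [set B :\ y; B] \in eset G) x].

(** The pair of C and x is determined by the upper end B = C + x and x, a tuple
    of distinct coordinates of [down_nbr G B]. *)
Lemma sum_star_tuple (n r : nat) (G : graph {set 'I_n}) :
  \sum_C #|[set x : r.-tuple 'I_n | star_tuple G C x]| =
  \sum_B #|down_nbr G B| ^_ r.
Proof.
pose P := [set p : {set 'I_n} * r.-tuple 'I_n | star_tuple G p.1 p.2].
pose Q := [set p : {set 'I_n} * r.-tuple 'I_n |
             all (fun y => y \in down_nbr G p.1) p.2 && uniq p.2].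
have -> : \sum_C #|[set x : r.-tuple 'I_n | star_tuple G C x]| = #|P|.
  exact: sum_card_slice.
have -> : \sum_B #|down_nbr G B| ^_ r = #|Q|.
  by under eq_bigr do rewrite -card_uniq_tuples; exact: sum_card_slice.
pose h (p : {set 'I_n} * r.-tuple 'I_n) := (p.1 :|: [set y in p.2], p.2).
have hinj : {in P &, injective h}.
  move=> [C x] [C' x'] /=; rewrite !inE /= => /and3P[_ /allP xC _].
  move=> /and3P[_ /allP xC' _] [D Dx]; rewrite -Dx in D xC' *.
  congr pair; apply/setP => y; move/setP/(_ y): D; rewrite !inE.
  have [yx|] := boolP (y \in val x); last by rewrite !orbF.
  by rewrite (negPf (xC _ yx)) (negPf (xC' _ yx)).
rewrite -(card_in_imset hinj); apply: eq_card => -[B x]; rewrite [RHS]inE /=.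
apply/imsetP/andP => [[[C x'] Cx' [-> ->]] | [/allP xB ux]].
  move: Cx'; rewrite inE /= => /and3P[ux' xC /allP xG]; split => //.
  by apply/allP => y yx; rewrite !inE yx orbT xG.
have DB : B :\: [set y in x] :|: [set y in x] = B.
  apply/setP => y; rewrite !inE; have [/xB|] := boolP (y \in val x).
    by rewrite inE => /andP[->].
  by rewrite orbF.
exists (B :\: [set y in x], x); last by rewrite /h /= DB.
rewrite inE /star_tuple /= DB; apply/and3P; split=> //; apply/allP => y yx.
  by rewrite !inE yx.
by have := xB y yx; rewrite inE => /andP[].
Qed.

Lemma all2_mkseq (X : finType) (A : seq {set X}) (f : nat -> X) :
  (forall i, i < size A -> f i \in nth set0 A i) ->
  all2 (fun x (a : {set X}) => x \in a) (mkseq f (size A)) A.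
Proof.
elim: A f => //= a A IHA f fA; rewrite (fA 0) //=.
rewrite -(addn0 1) iotaDl -map_comp; apply: (IHA (f \o S)) => i iA.
exact: (fA i.+1).
Qed.

(** The sets of a box of star tuples are pairwise disjoint and disjoint from C,
    because star tuples have distinct letters outside C; so the box serves as
    a placement of the words that represent H. *)
Lemma star_box_copy (U : finType) (H : graph U) (s : seq nat)
    (w : U -> nat -> option nat) (n : nat) (G : graph {set 'I_n})
    (C : {set 'I_n}) :
  partite_rep H s w -> 0 < size s -> all (leq 1) s -> has_box s (star_tuple G C) ->
  exists F : graph {set 'I_n}, subgraph F G /\ isomorphic F H.
Proof.
move=> wP s_gt0 s1 /has_boxP[A As AE].
have sA : size A = size s by rewrite -As size_map.
have cA i : i < size s -> #|nth set0 A i| = nth 0 s i.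
  by move=> ir; rewrite -As (nth_map set0) ?sA.
have nA i : i < size s -> 0 < nth 0 s i.
  by move=> ir; apply: (allP s1); apply: mem_nth.
have [x0 _] : exists x0, x0 \in nth set0 A 0.
  by apply/set0Pn; rewrite -card_gt0 cA // nA.
pose g i a := nth x0 (enum (nth set0 A i)) a.
have gA i a : i < size s -> a < nth 0 s i -> g i a \in nth set0 A i.
  by move=> ir am; rewrite -mem_enum mem_nth // -cardE cA.
have starP f : (forall i, i < size s -> f i \in nth set0 A i) ->
    star_tuple G C (mkseq f (size s)).
  by move=> fA; apply: AE; rewrite -sA; apply: all2_mkseq => i; rewrite sA; apply: fA.
have g0 i : i < size s -> g i 0 \in nth set0 A i by move=> ir; rewrite gA ?nA.
have gC i a : i < size s -> a < nth 0 s i -> g i a \notin C.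
  move=> ir am; pose f l := g l (if l == i then a else 0).
  have : star_tuple G C (mkseq f (size s)).
    by apply: starP => l lr; rewrite /f; case: eqP => [->|_]; rewrite ?gA // nA.
  case/and3P=> _ /allP gC _; apply: gC; apply/mapP; exists i; rewrite ?mem_iota //.
  by rewrite /f eqxx.
apply: (partite_rep_copy wP s1 _ gC).
  move=> i j a b ir jr ai bj D.
  have Dij : i = j.
    have [//|ij] := eqVneq i j.
    pose f l := if l == i then a else if l == j then b else 0.
    have : star_tuple G C (mkseq (fun l => g l (f l)) (size s)).
      apply: starP => l lr; rewrite /f.
      by do 2![case: eqP => [->|_]; rewrite ?gA //]; rewrite nA.
    case/and3P=> /mkseq_uniqP uf _ _; apply: uf => //.
    by rewrite /f !eqxx eq_sym (negPf ij).
  split=> //; move: D bj; rewrite -Dij /g => /eqP D bi; move: D.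
  by rewrite nth_uniq ?enum_uniq -?cardE ?cA // => /eqP.
move=> f fs i ir; rewrite /= placeE.
have /and3P[_ _ /allP] : star_tuple G C (mkseq (fun l => g l (f l)) (size s)).
  by apply: starP => l lr; rewrite gA ?fs.
by apply; apply/mapP; exists i; rewrite ?mem_iota.
Qed.

(** * Subdivisions *)

Lemma rel_graph_edge (T : finType) (V : {set T}) (r : rel T) (x y : T) :
  [set x; y] \in eset (rel_graph V r) -> [/\ x \in V, y \in V & r x y || r y x].
Proof.
rewrite inE => /exists_inP[a aV /exists_inP[b bV /and3P[ab rab /eqP D]]].
have /set2P xab : x \in [set a; b] by rewrite -D set21.
have /set2P yab : y \in [set a; b] by rewrite -D set22.
have xNy : x != y.
  by apply: contraNneq ab => Dxy; have := cards2 a b; rewrite -D Dxy cards2 eqxx;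
     case: (a == b).
by split; move: xNy; rewrite ?eqxx; case: xab yab => -> [] ->; rewrite ?eqxx ?rab ?orbT.
Qed.

Lemma first_end_uniq (T : finType) (e : {set T}) (x y : T) :
  first_end e x -> first_end e y -> x = y.
Proof.
move=> /andP[xe /forall_inP xmin] /andP[ye /forall_inP ymin].
by apply/enum_rank_inj/val_inj/anti_leq; rewrite xmin // ymin.
Qed.

Lemma last_end_uniq (T : finType) (e : {set T}) (x y : T) :
  last_end e x -> last_end e y -> x = y.
Proof.
move=> /andP[xe /forall_inP xmax] /andP[ye /forall_inP ymax].
by apply/enum_rank_inj/val_inj/anti_leq; rewrite xmax // ymax.
Qed.

Lemma set2_ends (T : finType) (x y : T) : enum_rank x <= enum_rank y ->
  first_end [set x; y] x /\ last_end [set x; y] y.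
Proof.
move=> xy; rewrite /first_end /last_end set21 set22; split;
  by apply/forall_inP => z /set2P[] ->.
Qed.

Lemma edge_ends (T : finType) (G : graph T) (e : {set T}) : e \in eset G ->
  exists x y, [/\ x != y, first_end e x & last_end e y].
Proof.
have /forall_inP/(_ e) : is_graph G by case: (G).
move=> He /He /andP[_ /cards2P[x [y [xy ->]]]].
have [xley|/ltnW ylex] := leqP (enum_rank x) (enum_rank y).
  by have [fx ly] := set2_ends xley; exists x, y.
by have [fy lx] := set2_ends ylex; exists y, x; rewrite eq_sym setUC.
Qed.

(** The edge condition of [partite_rep] need only be checked along the oriented
    relation that defines a subdivision. *)
Lemma subdivision_edge_rep (k : nat) (T : finType) (G : graph T) (r : nat)
    (w : T + {set T} * 'I_k -> nat -> option nat) :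
  {in subdiv_vset k G &, forall u v, subdiv_rel u v ->
    erases r (w u) (w v) \/ erases r (w v) (w u)} ->
  {in vset (subdivision k G) &, forall u v,
    [set u; v] \in eset (subdivision k G) ->
    erases r (w u) (w v) \/ erases r (w v) (w u)}.
Proof.
move=> wE u v uH vH /rel_graph_edge[_ _ /orP[]]; first exact: wE.
by move=> /wE[] //; [right | left].
Qed.

(** * Subdivisions of complete graphs *)

Section CompleteSubdivision.

Variables (k t : nat).

(** An element of 'I_t that satisfies P, as a natural number; it is used when P
    determines this element uniquely, and is 0 if no element satisfies P. *)
Definition val_of (P : pred 'I_t) : nat := odflt 0 (omap val [pick x | P x]).

(** The l-th new vertex on the edge e is reached after l./2 complete changes of
    a letter; if l is odd, then the letter at position l./2 is being changed. *)
Definition clique_word (u : 'I_t + {set 'I_t} * 'I_(2 * k + 1)) (p : nat) :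
    option nat :=
  match u with
  | inl x => if p == k then None else Some (val x)
  | inr (e, l) =>
      if p == k then Some (val (enum_rank e))
      else if odd l && (p == l./2) then None
      else Some (val_of (if p < l./2 then last_end e else first_end e))
  end.

(** The last letter is the rank of an edge among all sets of vertices. *)
Definition clique_sizes : seq nat := rcons (nseq k t) #|{set 'I_t}|.

Lemma val_of_first (e : {set 'I_t}) (x : 'I_t) :
  first_end e x -> val_of (first_end e) = x.
Proof.
move=> fx; rewrite /val_of; case: pickP => [y fy|/(_ x)]; last by rewrite fx.
by rewrite (first_end_uniq fx fy).
Qed.

Lemma val_of_last (e : {set 'I_t}) (x : 'I_t) :
  last_end e x -> val_of (last_end e) = x.
Proof.
move=> lx; rewrite /val_of; case: pickP => [y ly|/(_ x)]; last by rewrite lx.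
by rewrite (last_end_uniq lx ly).
Qed.

Lemma clique_rep : 0 < k -> 0 < t ->
  partite_rep (subdivision (2 * k + 1) (complete_graph t)) clique_sizes
    clique_word.
Proof.
move=> k_gt0 t_gt0.
have sz : size clique_sizes = k.+1 by rewrite size_rcons size_nseq.
have half_le (l : 'I_(2 * k + 1)) : l./2 <= k by have := ltn_ord l; lia.
have odd_lt (l : 'I_(2 * k + 1)) : odd l -> l./2 < k by have := ltn_ord l; lia.
have ltt P : val_of P < t by rewrite /val_of; case: pickP => /=.
split; rewrite ?sz.
- move=> u _ i a; rewrite ltnS leq_eqVlt nth_rcons size_nseq nth_nseq.
  case/predU1P => [->|ik].
    by case: u => [x|[e l]] /=; rewrite eqxx ?ltnn // => -[<-].
  rewrite ik; case: u => [x|[e l]] /=; rewrite (ltn_eqF ik); first by move=> [<-].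
  by case: ifP => // _ [<-].
- move=> [x|[e l]] _; first by exists k => // j _ /negPf /= ->.
  exists (if odd l then l./2 else k); first by case: ifP => [/odd_lt|_] //; exact: ltnW.
  by move=> j _ /=; case: (j == k) => //; case: (odd l) => //= /negPf ->.
- have ilr x e l : ~ (forall i, i < k.+1 ->
      clique_word (inl x) i = clique_word (inr (e, l)) i).
    by move=> /(_ k (ltnSn k)) /=; rewrite eqxx.
  move=> [x|[e l]] [y|[e' l']] uV vV D.
  + have := D 0 isT; rewrite /= eq_sym (gtn_eqF k_gt0) => -[xy].
    by congr inl; apply: val_inj.
  + by case: (ilr _ _ _ D).
  + by case: (ilr y e l) => i /D.
  + have := D k (ltnSn k); rewrite /= eqxx => -[/val_inj/enum_rank_inj De].
    rewrite -De in D *; congr (inr (_, _)).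
    have eE : e \in eset (complete_graph t) by move: uV; rewrite inE.
    have [x [y [xy fx ly]]] := edge_ends eE.
    have lt_half : forall l1 l2 : 'I_(2 * k + 1), l1./2 < l2./2 ->
        (forall i, i < k.+1 ->
          clique_word (inr (e, l1)) i = clique_word (inr (e, l2)) i) -> False.
      move=> l1 l2 lt12 /(_ l1./2).
      have lt1k : l1./2 < k by apply: leq_trans lt12 _.
      rewrite ltnS ltnW // => /(_ isT) /=.
      rewrite (ltn_eqF lt1k) eqxx andbT (ltn_eqF lt12) andbF ltnn lt12.
      case: ifP => // _ [] Dv; case/eqP: xy; apply: val_inj.
      by rewrite /= -(val_of_first fx) -(val_of_last ly) -Dv.
    have Dh : l./2 = l'./2.
      have [lt|lt|//] := ltngtP l./2 l'./2; first by case: (lt_half _ _ lt D).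
      by case: (lt_half _ _ lt) => i /D.
    have Do : odd l = odd l'.
      have [hk|] := ltnP l./2 k.
        have := D _ (ltnW hk : l./2 < k.+1); rewrite /= (ltn_eqF hk) -Dh eqxx !andbT.
        by do 2!case: odd.
      move=> kl; have := odd_lt l; have := odd_lt l'; rewrite -Dh.
      by do 2!case: odd => //; move=> h1 h2; have := leq_trans kl; lia.
    by apply: val_inj; rewrite /= -[LHS]odd_double_half Do Dh odd_double_half.
apply: subdivision_edge_rep => -[x|[e l]] [y|[e' l']] // uV vV /=.
  case/orP=> /andP[xe /eqP l'E]; right; exists k; split => //=.
  - by move=> j _; rewrite l'E; case: (j == k).
  - by rewrite eqxx.
  - by move=> j _ /negPf ->; rewrite l'E (val_of_first xe).
  - move=> j _; case: (j == k) => //; case: ifP => // /andP[/odd_lt ol _].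
    by move: l'E ol; lia.
  - by rewrite eqxx.
  - move=> j jk /negPf jk'; rewrite jk'; have -> : odd l' = false by move: l'E; lia.
    have -> : j < l'./2 by move: l'E jk jk'; lia.
    by rewrite (val_of_last xe).
case/andP=> /eqP <- /eqP ll'.
have [ol|el] := boolP (odd l).
  have lk := odd_lt l ol; right; exists l./2; split; first exact: ltnW.
  - by move=> j _ /=; rewrite -ll' /= ol; case: (j == k).
  - by rewrite /= ol eqxx (ltn_eqF lk).
  - move=> j jk jl /=; rewrite (negPf jl) -ll' /= ol /= uphalf_half ol.
    by case: eqP => // _; congr (Some (val_of (if _ then _ else _))); lia.
have lk : l./2 < k by have := ltn_ord l'; lia.
left; exists l./2; split; first exact: ltnW.
- by move=> j _ /=; rewrite (negPf el) /=; case: (j == k).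
- by rewrite /= -ll' /= uphalf_half (negPf el) eqxx (ltn_eqF lk).
- move=> j jk jl /=; rewrite -ll' /= uphalf_half (negPf el) /= add0n (negPf jl).
  by [].
Qed.

End CompleteSubdivision.

(** * Subdivisions of complete bipartite graphs *)

(** Hence the edges of a complete bipartite graph are traversed from left to
    right in its subdivisions. *)
Lemma enum_rank_inl_inr (S T : finType) (x : S) (y : T) :
  enum_rank (inl x : S + T) <= enum_rank (inr y : S + T).
Proof.
pose e : seq (S + T) := map inl (enum S) ++ map inr (enum T).
have De : enum {: S + T} = e by rewrite enumT unlock /= /sum_enum -!enumT.
have rankE z : (enum_rank z : nat) = index z e.
  rewrite -De -{2}(nth_enum_rank z z) index_uniq ?enum_uniq //.
  by rewrite -cardE ltn_ord.
rewrite !rankE /e !index_cat.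
have -> : (inl x : S + T) \in map inl (enum S) by rewrite map_f ?mem_enum.
have /negPf-> : (inr y : S + T) \notin map inl (enum S).
  by apply/negP => /mapP[].
by rewrite (leq_trans (ltnW _) (leq_addr _ _)) // index_mem map_f ?mem_enum.
Qed.

Lemma erases_near_full (r : nat) (w w' : nat -> option nat) :
  erases r w w' -> near_full r w'.
Proof.
by case=> i [ir wf _ Dw']; exists i => // j jr ji; rewrite Dw' ?wf.
Qed.

Section BipartiteSubdivision.

Variables (k t : nat).

(** The q-th word on the path from left vertex i to right vertex j, for
    q <= 2 * k.  After s = q./2 complete changes, P_j equals uphalf s and Q
    equals s./2; if q is odd, then the next change is under way, and erases P_j
    or Q according to the parity of s.  Position t holds z, and Q is at
    position t + 1. *)
Definition stair_word (i j q p : nat) : option nat :=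
  if p < t then
    if p == j then if odd q && ~~ odd q./2 then None else Some (uphalf q./2)
    else Some 0
  else if p == t then Some i
  else if odd q && odd q./2 then None else Some q./2./2.

(** The j-th right branch vertex: the end of any staircase ending at j, with z
    erased. *)
Definition sink_word (j p : nat) : option nat :=
  if p == t then None else stair_word 0 j (2 * k) p.

(** The indices of the two ends of an edge of the complete bipartite graph. *)
Definition left_end (e : {set 'I_t + 'I_t}) : nat :=
  val_of (fun i => inl i \in e).
Definition right_end (e : {set 'I_t + 'I_t}) : nat :=
  val_of (fun j => inr j \in e).

Definition biclique_word (u : ('I_t + 'I_t) + {set 'I_t + 'I_t} * 'I_(2 * k)) :
    nat -> option nat :=
  match u with
  | inl (inl i) => stair_word i 0 0
  | inl (inr j) => sink_word j
  | inr (e, l) => stair_word (left_end e) (right_end e) l.+1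
  end.

(** The bounds on P_0, ..., P_(t-1), z and Q, in this order. *)
Definition biclique_sizes : seq nat :=
  rcons (rcons (nseq t (uphalf k).+1) t) k./2.+1.

Lemma stair_erase (i j q : nat) : j < t -> odd q ->
  erases t.+2 (stair_word i j q.-1) (stair_word i j q) /\
  erases t.+2 (stair_word i j q.+1) (stair_word i j q).
Proof.
move=> jt oq; pose s := q./2.
have Dq : q = s.*2.+1 by rewrite -[LHS]odd_double_half oq.
have full a p : stair_word i j a.*2 p != None.
  by rewrite /stair_word odd_double; do ?case: ifP => //.
have erased p : stair_word i j q p =
   if p == (if odd s then t.+1 else j) then None else stair_word i j q p.
  case: ifP => // /eqP ->; rewrite /stair_word oq -/s /=.
  have [os|os] := boolP (odd s); last by rewrite jt eqxx.
  by rewrite ltnNge leqnSn /= gtn_eqF.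
have e0 : q.-1 = s.*2 by rewrite Dq.
have e1 : q.+1 = s.+1.*2 by rewrite Dq.
split; rewrite ?e0 ?e1; exists (if odd s then t.+1 else j); split => //;
  try by [case: ifP; lia]; try by rewrite erased eqxx.
- move=> p pt np; rewrite /stair_word Dq /= odd_double /= uphalf_double doubleK.
  by move: np; case: (odd s) => np; rewrite ?andbF //=; do ?[case: ifP => //]; lia.
- move=> p pt np; rewrite /stair_word Dq /= odd_double /= uphalf_double doubleK.
  move: np; rewrite !uphalf_half; case: (odd s) => np /=; do ?[case: ifP => //]; lia.
Qed.

(** The staircases of distinct pairs (i, j) only share their starting words. *)
Lemma stair_inj (i j q i' j' q' : nat) : j < t -> j' < t ->
  (forall p, p < t.+2 -> stair_word i j q p = stair_word i' j' q' p) ->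
  i = i' /\ (q = 0 /\ q' = 0 \/ j = j' /\ q = q').
Proof.
move=> jt j't D; split.
  by have := D t (leqW (ltnSn t)); rewrite /stair_word ltnn eqxx => -[].
have column a b c a' b' c' : b < t -> 0 < c ->
    (forall p, p < t.+2 -> stair_word a b c p = stair_word a' b' c' p) -> b = b'.
  move=> bt c_gt0 /(_ b (leqW (leqW bt))).
  rewrite /stair_word bt eqxx; case: eqP => // _.
  case: ifP => // oc [] uc.
  by move: oc c_gt0 uc; rewrite uphalf_half; lia.
have [[-> ->] | Dj] : (q = 0 /\ q' = 0) \/ j = j'.
  have [-> | q_gt0] := posnP q.
    have [-> | q'_gt0] := posnP q'; first by left.
    by right; rewrite (column i' j' q' i j q j't q'_gt0) // => p /D.
  by right; apply: (column i j q i' j' q' jt q_gt0).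
  by left.
right; split=> //; move: (D j (leqW (leqW jt))) (D t.+1 (ltnSn _)); rewrite -Dj.
rewrite /stair_word jt eqxx ltnNge leqnSn /= gtn_eqF // !uphalf_half.
move: (odd_double_half q) (odd_double_half q').
move: (odd_double_half q./2) (odd_double_half q'./2).
by case: (odd q) (odd q') (odd q./2) (odd q'./2) => [] [] [] [] //= ? ? ? ?;
  move=> /(congr1 (odflt 0)) /= ? /(congr1 (odflt 0)) /= ?; lia.
Qed.

Lemma left_right_end (e : {set 'I_t + 'I_t}) :
  e \in eset (complete_bipartite t t) ->
  exists i j : 'I_t, [/\ e = [set inl i; inr j], left_end e = i,
    right_end e = j, first_end e (inl i) & last_end e (inr j)].
Proof.
rewrite inE => /exists_inP[x _ /exists_inP[y _ /and3P[_ xy /eqP De]]].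
case: x y xy De => [i|//] [//|j] _ De.
have [fi lj] := set2_ends (enum_rank_inl_inr i j).
exists i, j; rewrite -De in fi lj *; split=> //.
  rewrite /left_end /val_of; case: pickP => [i' | /(_ i)]; last by rewrite De set21.
  by rewrite De => /set2P[] // [->].
rewrite /right_end /val_of; case: pickP => [i' | /(_ j)]; last by rewrite De set22.
by rewrite De => /set2P[] // [->].
Qed.

Lemma biclique_rep : 0 < k ->
  partite_rep (subdivision (2 * k) (complete_bipartite t t)) biclique_sizes
    biclique_word.
Proof.
move=> k_gt0.
have sz : size biclique_sizes = t.+2 by rewrite !size_rcons size_nseq.
have stair_full a b c p : ~~ odd c -> stair_word a b c p != None.
  by move=> /negPf oc; rewrite /stair_word oc /=; do ?case: ifP.
have stair_bound a b c p v : a < t -> c <= 2 * k -> p < t.+2 ->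
    stair_word a b c p = Some v -> v < nth 0 biclique_sizes p.
  move=> at_ ck pt; rewrite /stair_word !nth_rcons !size_rcons !size_nseq nth_nseq.
  have [ltpt | letp] := ltnP p t.
    rewrite ltnS (ltnW ltpt); case: eqP => _; last by case=> <-.
    by case: ifP => // _ [<-]; rewrite !uphalf_half; lia.
  have [-> | npt] := eqVneq p t; first by rewrite ltnSn => -[<-].
  have -> : p = t.+1 by move: npt letp pt; lia.
  by rewrite ltnn eqxx; case: ifP => // _ [<-]; lia.
have stair_near_full a b c : b < t -> near_full t.+2 (stair_word a b c).
  move=> bt; have [oc | ec] := boolP (odd c).
    by have [E _] := stair_erase a bt oc; apply: erases_near_full E.
  by exists t; [rewrite ltnS leqnSn | move=> p _ _; apply: stair_full].
have sink_erases i j : erases t.+2 (stair_word i j (2 * k)) (sink_word j).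
  exists t; split=> [||| p _ pt]; first by rewrite ltnS leqnSn.
  - by move=> p _; apply: stair_full; rewrite mul2n odd_double.
  - by rewrite /sink_word eqxx.
  - by rewrite /sink_word /stair_word (negPf pt).
have inV e l : inr (e, l) \in subdiv_vset (2 * k) (complete_bipartite t t) ->
    e \in eset (complete_bipartite t t) by rewrite inE.
split; rewrite ?sz.
- move=> [[i|j]|[e l]] uV p v pt /=.
  + by apply: stair_bound.
  + rewrite /sink_word; case: eqP => // _; apply: stair_bound => //.
    exact: leq_ltn_trans (ltn_ord j).
  + by apply: stair_bound => //; have [i [j [_ -> _ _ _]]] := left_right_end (inV _ _ uV).
- move=> [[i|j]|[e l]] uV /=.
  + by apply: stair_near_full; apply: leq_ltn_trans (ltn_ord i).
  + exact: erases_near_full (sink_erases 0 j).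
  + have [i [j [_ _ Dj _ _]]] := left_right_end (inV _ _ uV).
    by apply: stair_near_full; rewrite Dj.
- have sink_stair j a b c : ~ (forall p, p < t.+2 -> sink_word j p = stair_word a b c p).
    move=> /(_ t); rewrite ltnS leqnSn => /(_ isT).
    by rewrite /sink_word /stair_word eqxx ltnn.
  move=> [[i|j]|[e l]] [[i'|j']|[e' l']] uV vV /= D.
  + have t_gt0 : 0 < t by apply: leq_ltn_trans (ltn_ord i).
    have [Di _] := stair_inj t_gt0 t_gt0 D.
    by do 2!congr inl; apply: val_inj.
  + by case: (@sink_stair j' i 0 0) => p /D.
  + have [i1 [j1 [_ _ Dj _ _]]] := left_right_end (inV _ _ vV).
    have t_gt0 : 0 < t by apply: leq_ltn_trans (ltn_ord i).
    by have [|_ [[]|[]]] := stair_inj t_gt0 _ D; rewrite // Dj.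
  + by case: (@sink_stair j i' 0 0) => p /D.
  + have jt := ltn_ord j; have := D j (leqW (leqW jt)).
    rewrite /sink_word /stair_word (ltn_eqF jt) jt eqxx mul2n odd_double /= doubleK.
    case: eqP => [Dj _ | _ []]; first by congr (inl (inr _)); apply: val_inj.
    by rewrite uphalf_half; lia.
  + by case: (sink_stair _ _ _ _ D).
  + have [i1 [j1 [_ _ Dj _ _]]] := left_right_end (inV _ _ uV).
    have t_gt0 : 0 < t by apply: leq_ltn_trans (ltn_ord i').
    by have [|_ [[]|[]]] := stair_inj _ t_gt0 D; rewrite // Dj.
  + by case: (@sink_stair j' (left_end e) (right_end e) l.+1) => p /D.
  + have [i1 [j1 [De Di Dj _ _]]] := left_right_end (inV _ _ uV).
    have [i2 [j2 [De' Di' Dj' _ _]]] := left_right_end (inV _ _ vV).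
    have [||Dl [[//]|[Dr [Dq]]]] := stair_inj _ _ D; rewrite ?Dj ?Dj' //.
    have i12 : i1 = i2 by apply: val_inj; rewrite /= -Di -Di'.
    have j12 : j1 = j2 by apply: val_inj; rewrite /= -Dj -Dj'.
    congr (inr (_, _)); last exact: val_inj.
    by rewrite De De' i12 j12.
apply: subdivision_edge_rep => -[x|[e l]] [y|[e' l']] // uV vV /=.
  have [i [j [De Di Dj fi lj]]] := left_right_end (inV _ _ vV).
  rewrite Di Dj; case/orP=> /andP[xe /eqP l'E].
    rewrite (first_end_uniq xe fi) l'E; left.
    have [[p [pt wf wp Dw]] _] := @stair_erase i j 1 (ltn_ord j) isT.
    exists p; split => // p' p't; first exact: stair_full.
    by move=> pp'; rewrite Dw // /stair_word /= !if_same.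
  by rewrite (last_end_uniq xe lj) l'E; right.
case/andP=> /eqP <- /eqP <-.
have [i [j [De Di Dj fi lj]]] := left_right_end (inV _ _ uV); rewrite Di Dj.
have [ol | el] := boolP (odd l.+1).
  by right; have [_] := stair_erase i (ltn_ord j) ol.
by left; have [] := @stair_erase i j l.+2 (ltn_ord j) el.
Qed.

End BipartiteSubdivision.

(** * The box theorem *)

Local Open Scope ring_scope.

(** Convexity: a bound on the sum of the falling factorials of the numbers d y
    bounds their sum.  The summand m is the price of replacing the falling
    factorial by the m-th power of d y - m, truncated at 0. *)
Lemma sum_le_of_ffact (R : realType) (T : finType) (d : T -> nat) (m : nat)
    (K : R) : (0 < m)%N -> 0 <= K ->
  (\sum_y d y ^_ m)%N%:R <= #|T|%:R * K ^+ m ->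
  (\sum_y d y)%N%:R <= #|T|%:R * (m%:R + K).
Proof.
case: m => // m _ K_ge0 dK.
have le1 : (\sum_y d y <= #|T| * m.+1 + \sum_y (d y - m.+1))%N.
  rewrite -sum_nat_const -big_split; apply: leq_sum => y _ /=.
  by rewrite -leq_subLR.
apply: (@le_trans _ _ (#|T| * m.+1 + \sum_y (d y - m.+1))%N%:R).
  by rewrite ler_nat.
rewrite natrD natrM mulrDr lerD2l.
rewrite -(@ler_pXn2r _ m.+1) ?nnegrE ?mulr_ge0 //.
rewrite -natrX (@le_trans _ _ (#|T| ^ m * \sum_y d y ^_ m.+1)%N%:R) //.
  rewrite ler_nat (leq_trans (sum_pow_mean _ _)) // leq_mul2l leq_sum ?orbT // => y _.
  exact: subn_expn_ffact.
by rewrite natrM exprMn exprSr -mulrA natrX ler_wpM2l // exprn_ge0.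
Qed.

Lemma expr_powR (R : realType) (c n d : R) (m : nat) : 0 <= c -> 0 < n ->
  (0 < m)%N ->
  (c `^ m%:R^-1 * n `^ (1 - d / m%:R)) ^+ m = c * n `^ (m%:R - d).
Proof.
move=> c_ge0 n_gt0 m_gt0; have m0 : m%:R != 0 :> R by rewrite pnatr_eq0 -lt0n.
rewrite exprMn -!powR_mulrn ?powR_ge0 // -!powRrM mulVf // powRr1 //.
by rewrite mulrBl mul1r divfK.
Qed.

Lemma prod_seq_gt0 (s : seq nat) : all (leq 1) s -> (0 < \prod_(m <- s) m)%N.
Proof.
elim: s => [|m s IHs] /=; first by rewrite big_nil.
by rewrite big_cons muln_gt0 => /andP[-> /IHs].
Qed.

(** Erdos's box theorem.  The bound M on the size of the last set of a box only
    affects the constant c, not the exponent. *)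
Lemma box_free_bound (R : realType) (s : seq nat) (M : nat) :
  all (leq 1) s -> exists2 c : R, 0 <= c &
    forall (X : finType) (E : seq X -> bool), (0 < #|X|)%N ->
    ~~ has_box (rcons s M) E ->
    #|[set y : (size s).+1.-tuple X | E y]|%:R <=
      c * #|X|%:R `^ ((size s).+1%:R - (\prod_(m <- s) m)%:R^-1).
Proof.
elim: s => [_|m s IHs] /=.
  exists M%:R => // X E X_gt0; rewrite big_nil invr1 subrr powRr0 mulr1 => nE.
  rewrite ler_nat card_set_cons leqNgt; apply: contra nE.
  rewrite (eq_bigr (fun=> #|[set x | E [:: x]]|)) => [|y _]; last by rewrite (tuple0 y).
  rewrite sum_nat_const card_tuple expn0 mul1n => ltM.
  have [A sA cA] : exists2 A : {set X}, A \subset [set x | E [:: x]] & #|A| = M.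
    exists [set x in take M (enum [set x | E [:: x]])].
      by apply/subsetP => x; rewrite inE => /mem_take; rewrite mem_enum.
    rewrite cardsE; have /card_uniqP-> := take_uniq M (enum_uniq [set x | E [:: x]]).
    by rewrite size_takel // -cardE ltnW.
  apply/existsP; exists A; rewrite cA eqxx /=; apply/forall_inP => x xA.
  by have := subsetP sA x xA; rewrite inE.
case/andP=> m_gt0 s1; have [c c_ge0 cP] := IHs s1.
set r := (size s).+1.
have := prod_seq_gt0 s1; set P := (\prod_(m <- s) m)%N => P_gt0.
exists (m%:R + c `^ m%:R^-1) => [|X E X_gt0 nE].
  by rewrite addr_ge0 ?powR_ge0.
rewrite big_cons -/P.
set n : R := #|X|%:R; have n_ge1 : 1 <= n by rewrite ler1n.
have n_gt0 : 0 < n by apply: lt_le_trans n_ge1.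
have n0 : n != 0 by rewrite gt_eqF.
pose d : R := P%:R^-1.
(* K is the solution of n^m c n^(r - d) = n^r K^m: the left-hand side bounds the
   sum over the m-tuples of letters, by induction; on the right, n^r is the
   number of words y. *)
pose K := c `^ m%:R^-1 * n `^ (1 - d / m%:R).
have m0 : m%:R != 0 :> R by rewrite pnatr_eq0 -lt0n.
have d_le : d / m%:R <= 1.
  by rewrite /d -invfM -natrM invf_le1 ?ltr0n ?muln_gt0 ?P_gt0 // ler1n muln_gt0 P_gt0.
have cardT : #|{: r.-tuple X}|%:R = n ^+ r :> R by rewrite card_tuple natrX.
rewrite card_set_cons; apply: (@le_trans _ _ (n ^+ r * (m%:R + K))).
  rewrite -cardT; apply: sum_le_of_ffact => //.
    by rewrite mulr_ge0 ?powR_ge0.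
  rewrite cardT expr_powR // sum_ffact_slice natr_sum.
  apply: (@le_trans _ _ (\sum_(a : m.-tuple X | uniq a) c * n `^ (r%:R - d))).
    apply: ler_sum => a ua.
    exact: (cP X (fun y => [forall x in [set x in a], E (x :: y)]) X_gt0
      (box_free_slice nE ua)).
  rewrite sumr_const -[leLHS]mulr_natr.
  rewrite (_ : n ^+ r * _ = c * n `^ (r%:R - d) * n ^+ m); last first.
    rewrite -!powR_mulrn ?ltW // mulrCA -!mulrA -!powRD ?n0 ?implybT //.
    by congr (_ * _ `^ _); ring.
  rewrite ler_wpM2l ?mulr_ge0 ?powR_ge0 // -natrX ler_nat -card_tuple.
  exact: max_card.
have -> : r.+1%:R - (m * P)%:R^-1 = r%:R + (1 - d / m%:R) :> R.
  by rewrite -natr1 natrM invfM /d; ring.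
rewrite powRD ?n0 ?implybT // powR_mulrn ?(ltW n_gt0) // [leRHS]mulrCA.
rewrite ler_wpM2l ?exprn_ge0 ?(ltW n_gt0) //.
rewrite mulrDl lerD2r ler_peMr //.
by rewrite -[leLHS](powRr0 n) ler_powR // subr_ge0.
Qed.

(** * Extremal numbers and their asymptotics *)

(** The number M, the size of the part of the last letters, affects only c. *)
Lemma extremal_bound (R : realType) (U : finType) (H : graph U) (s : seq nat)
    (M : nat) (w : U -> nat -> option nat) :
  partite_rep H (rcons s M) w -> all (leq 1) (rcons s M) ->
  exists2 c : R, 0 <= c & forall n, (0 < n)%N ->
    (extremal (hypercube n) H)%:R <=
    c * n%:R `^ (1 - (size s).+1%:R^-1 * (\prod_(m <- s) m)%:R^-1) * 2 ^+ n.
Proof.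
move=> wP s1; have s1' : all (leq 1) s by move: s1; rewrite all_rcons => /andP[].
have [c c_ge0 cP] := box_free_bound R M s1'.
set r := (size s).+1 in cP *; set P := (\prod_(m <- s) m)%N in cP *.
have P_gt0 : (0 < P)%N by apply: prod_seq_gt0.
have r_gt0 : (0 < r)%N by [].
exists (r%:R + c `^ r%:R^-1) => [|n n_gt0]; first by rewrite addr_ge0 ?powR_ge0.
set x : R := n%:R; have x_ge1 : 1 <= x by rewrite ler1n.
have x_gt0 : 0 < x by apply: lt_le_trans x_ge1.
pose d : R := P%:R^-1.
pose K := c `^ r%:R^-1 * x `^ (1 - d / r%:R).
have K_ge0 : 0 <= K by rewrite mulr_ge0 ?powR_ge0.
rewrite (mulrC r%:R^-1) -/d; set b := 1 - d / r%:R.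
have b_ge0 : 0 <= b.
  by rewrite subr_ge0 /d -invfM -natrM invf_le1 ?ltr0n ?ler1n ?muln_gt0 ?P_gt0.
have xb_ge1 : 1 <= x `^ b by rewrite -[leLHS](powRr0 x) ler_powR.
rewrite /extremal; elim/big_ind: _ => [|y z yb zb|G /andP[sG /asboolP freeG]].
- by rewrite !mulr_ge0 ?addr_ge0 ?powR_ge0 ?exprn_ge0.
- by rewrite /maxn; case: ifP.
have nobox C : ~~ has_box (rcons s M) (star_tuple G C).
  by apply/negP => hb; apply/freeG/(star_box_copy wP _ s1 hb); rewrite size_rcons.
have card2 : #|{set 'I_n}|%:R = 2 ^+ n :> R.
  by rewrite -cardsT -powersetT card_powerset cardsT card_ord natrX.
rewrite nedges_down //; apply: (@le_trans _ _ (2 ^+ n * (r%:R + K))).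
  rewrite -card2; apply: sum_le_of_ffact => //.
  rewrite expr_powR // -sum_star_tuple natr_sum.
  rewrite mulr_natl -sumr_const; apply: ler_sum => C _.
  by have := cP 'I_n (star_tuple G C); rewrite card_ord; apply.
by rewrite mulrC ler_wpM2r ?exprn_ge0 // mulrDl lerD2r ler_peMr.
Qed.

Local Open Scope classical_set_scope.
Local Open Scope ring_scope.

Lemma powR_little_o (R : realType) (b : R) : b < 1 ->
  (fun n : nat => n%:R `^ b * 2 ^+ n : R) =o_\oo
  (fun n : nat => (nedges (hypercube n))%:R : R).
Proof.
move=> b1; apply/eqoP => e e_gt0; near=> n.
have n_gt0 : (0 < n)%N by near: n; exact: nbhs_infty_gt.
have nx : (2 / e) `^ (1 - b)^-1 <= n%:R by near: n; exact: nbhs_infty_ger.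
set x : R := n%:R in nx *; have x_gt0 : 0 < x by rewrite ltr0n.
rewrite !ger0_norm ?mulr_ge0 ?powR_ge0 ?exprn_ge0 //.
have -> : (nedges (hypercube n))%:R = x * 2 ^+ n / 2 :> R.
  have := congr1 (fun m => m%:R : R) (nedges_hypercube n).
  by rewrite -muln2 !natrM natrX => <-; rewrite mulfK.
have b0 : 0 < 1 - b by rewrite subr_gt0.
have : 2 / e <= x `^ (1 - b).
  have e2 : 0 <= 2 / e by rewrite divr_ge0 // ltW.
  rewrite (_ : 2 / e = ((2 / e) `^ (1 - b)^-1) `^ (1 - b)); last first.
    by rewrite -powRrM mulVf ?powRr1 // lt0r_neq0.
  by rewrite ge0_ler_powR ?nnegrE ?powR_ge0 ?(ltW b0) ?(ltW x_gt0).
rewrite ler_pdivrMr // => xe.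
have Dx : x = x `^ (1 - b) * x `^ b.
  by rewrite -powRD ?subrK ?powRr1 ?(ltW x_gt0) // gt_eqF ?implybT.
rewrite {2}Dx (_ : e * _ = x `^ (1 - b) * e * (x `^ b * 2 ^+ n) / 2); last by ring.
by rewrite ler_pdivlMr // mulrC ler_wpM2r // mulr_ge0 ?powR_ge0 ?exprn_ge0.
Unshelve. all: by end_near. Qed.

(** The exponent a of the bound may be smaller than the exponent b of g. *)
Lemma hypercube_asymptotics (R : realType) (f : nat -> R) (a b c : R) :
  a <= b -> b < 1 -> 0 <= c -> (forall n, 0 <= f n) ->
  (forall n, (0 < n)%N -> f n <= c * n%:R `^ a * 2 ^+ n) ->
  let cubeE : nat -> R := fun n => (nedges (hypercube n))%:R in
  let g : nat -> R := fun n => n%:R `^ b * 2 ^+ n in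
  [/\ f =O_\oo g, g =o_\oo cubeE & f =o_\oo cubeE].
Proof.
move=> ab b1 c_ge0 f_ge0 fP cubeE g.
have fg n : (0 < n)%N -> `|f n| <= c * `|g n|.
  move=> n_gt0; rewrite !ger0_norm ?mulr_ge0 ?powR_ge0 ?exprn_ge0 //.
  apply: le_trans (fP n n_gt0) _; rewrite mulrA ler_wpM2r ?exprn_ge0 //.
  by rewrite ler_wpM2l // ler_powR // ler1n.
have go := powR_little_o b1.
split=> //.
  apply/eqO_exP; exists (c + 1); first by rewrite ltr_wpDl.
  near=> n; have n_gt0 : (0 < n)%N by near: n; exact: nbhs_infty_gt.
  by apply: le_trans (fg n n_gt0) _; rewrite ler_wpM2r // lerDl.
have c1 : 0 < c + 1 by rewrite ltr_wpDl.
apply/eqoP => e e_gt0; have ec : 0 < e / (c + 1) by rewrite divr_gt0.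
move/eqoP/(_ _ ec) : go => go; near=> n.
have n_gt0 : (0 < n)%N by near: n; exact: nbhs_infty_gt.
have : `|g n| <= e / (c + 1) * `|cubeE n| by near: n; exact: go.
move=> gn; apply: le_trans (fg n n_gt0) _.
apply: (@le_trans _ _ ((c + 1) * `|g n|)); first by rewrite ler_wpM2r // lerDl.
by rewrite -ler_pdivlMl // mulrA (mulrC _ e).
Unshelve. all: by end_near. Qed.

Lemma clique_sizes_gt0 (k t : nat) : (0 < t)%N -> all (leq 1) (clique_sizes k t).
Proof.
move=> t_gt0; rewrite all_rcons all_nseq t_gt0 orbT andbT.
by apply/card_gt0P; exists set0.
Qed.

Lemma biclique_sizes_gt0 (k t : nat) : (0 < t)%N ->
  all (leq 1) (biclique_sizes k t).
Proof. by move=> t_gt0; rewrite !all_rcons all_nseq t_gt0 !orbT. Qed.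

Lemma prod_nseq (m n : nat) : (\prod_(i <- nseq n m) i = m ^ n)%N.
Proof. by rewrite big_nseq -Monoid.iteropE. Qed.

(** The exponent 1 - 1 / (r p) obtained for the subdivision of K_{t,t} is at
    most the exponent b' of the theorem. *)
Lemma biclique_exponent_le (k t : nat) : (3 <= k)%N ->
  (t.+2 * ((uphalf k).+1 ^ t * t) <= (2 * t ^ 3 + 4 * t) * k ^ (t ^ 2))%N.
Proof.
move=> k3; rewrite (mulnC _ t) mulnA; apply: leq_mul; first by rewrite !expnS expn0; nia.
have mk : ((uphalf k).+1 <= k)%N by rewrite uphalf_half; lia.
apply: (@leq_trans (k ^ t)); first by case: (t) => // t'; rewrite leq_exp2r.
by rewrite leq_pexp2l //; [lia | rewrite expnS expn1; nia].
Qed.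

Theorem theorem2 (R : realType) (k t : nat) (k_gt0 : (0 < k)%N)
    (t_gt0 : (0 < t)%N) :
  let cubeE : nat -> R := fun n => (nedges (hypercube n))%:R in
  let H := subdivision (2 * k + 1) (complete_graph t) in
  let H' := subdivision (2 * k) (complete_bipartite t t) in
  let b : R := 1 - (k + 1)%:R^-1 * t%:R ^- k in
  let b' : R := 1 - (2 * t ^ 3 + 4 * t)%:R^-1 * k%:R ^- (t ^ 2) in
  let f : nat -> R := fun n => (extremal (hypercube n) H)%:R in
  let f' : nat -> R := fun n => (extremal (hypercube n) H')%:R in
  let g : nat -> R := fun n => n%:R `^ b * 2 ^+ n in
  let g' : nat -> R := fun n => n%:R `^ b' * 2 ^+ n in
  [/\ layered H, layered H',
      [/\ f =O_\oo g, g =o_\oo cubeE & f =o_\oo cubeE] &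
      (4 <= k)%N -> ~~ odd k ->
      [/\ f' =O_\oo g', g' =o_\oo cubeE & f' =o_\oo cubeE]].
Proof.
move=> cubeE H H' b b' f f' g g'.
have HP := clique_rep k_gt0 t_gt0; have H'P := biclique_rep t k_gt0.
have Hs := clique_sizes_gt0 k t_gt0; have H's := biclique_sizes_gt0 k t_gt0.
split.
- by apply: (partite_rep_layered HP _ Hs); rewrite size_rcons.
- by apply: (partite_rep_layered H'P _ H's); rewrite size_rcons.
- have [c c_ge0 cP] := extremal_bound R HP Hs.
  apply: (hypercube_asymptotics _ _ c_ge0 _ cP) => //.
    by rewrite /b size_nseq prod_nseq natrX addn1.
  by rewrite /b gtrBl mulr_gt0 ?invr_gt0 ?exprn_gt0 ?ltr0n ?addn1.
move=> k4 _; have [c c_ge0 cP] := extremal_bound R H'P H's.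
have den_gt0 : (0 < 2 * t ^ 3 + 4 * t)%N by rewrite addn_gt0 !muln_gt0 t_gt0 orbT.
apply: (hypercube_asymptotics _ _ c_ge0 _ cP) => //.
  rewrite size_rcons size_nseq big_rcons /= prod_nseq /b' lerB // -natrX.
  rewrite -!invfM -!natrM lef_pV2 ?posrE ?ltr0n ?muln_gt0 ?expn_gt0
    ?k_gt0 ?t_gt0 ?den_gt0 //.
  by rewrite ler_nat biclique_exponent_le // ltnW.
by rewrite /b' gtrBl mulr_gt0 ?invr_gt0 ?exprn_gt0 ?ltr0n.
Qed.
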